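(* Let $\Sigma$ be a $d\times d$ symmetric positive definite matrix, $\gamma\in\mathbb{R}^d$, $X\sim\mathrm{N}_d(0,\Sigma)$, and let $U$ be a random variable independent of $X$ with the standard Rayleigh density $g_U(u)=u\,e^{-u^2/2}$ for $u\ge 0$ (and $0$ for $u<0$). Put $$\Omega=\Sigma+\gamma\gamma^\top,\qquad \alpha^2=\gamma^\top\Sigma^{-1}\gamma,\qquad \eta=(1+\alpha^2)^{-1/2}\,\Sigma^{-1}\gamma.$$ Then the random variable $Z=U\gamma+X$ has density at $z\in\mathbb{R}^d$ $$f_Z(z;\gamma,\Sigma)=(2\pi)^{1/2}(1+\alpha^2)^{-1/2}\,\varphi_d(z;\Omega)\,\Phi(\eta^\top z)\,\left\{\zeta(\eta^\top z)+\eta^\top z\right\}.$$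
   Context: $\varphi_d(z;\Omega)$ denotes the density at $z$ of the normal distribution $\mathrm{N}_d(0,\Omega)$; $\varphi$ and $\Phi$ denote the density and the distribution function of the univariate standard normal distribution; $\zeta(t)=\varphi(t)/\Phi(t)$, $t\in\mathbb{R}$, is the inverse Mills ratio. *)

(* Defs.v *)
From HB Require Import structures.
From mathcomp Require Import all_boot all_order all_algebra.
From mathcomp Require Import all_classical all_reals all_analysis.

Set Implicit Arguments.
Unset Strict Implicit.
Unset Printing Implicit Defensive.

Import Order.TTheory GRing.Theory Num.Theory.
Import numFieldNormedType.Exports.

Local Open Scope classical_set_scope.
Local Open Scope ring_scope.

Definition measure_cV_display : measure_display -> measure_display.
Proof. exact. Qed.

(* Column vectors carry the product sigma-algebra, generated by the coordinate
   maps, exactly as n.-tuple T does in the library; for T = R this is the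
   Borel sigma-algebra of R^n. *)
Section measurable_cV.
Context {d : measure_display} {T : measurableType d} (n : nat).

Let coor (i : 'I_n) (x : 'cV[T]_n) : T := x i ord0.

Let cV_set0 : g_sigma_preimage coor set0.
Proof. exact: sigma_algebra0. Qed.

Let cV_setC A : g_sigma_preimage coor A -> g_sigma_preimage coor (~` A).
Proof. exact: sigma_algebraC. Qed.

Let cV_bigcup (F : (set 'cV[T]_n)^nat) :
  (forall i, g_sigma_preimage coor (F i)) ->
  g_sigma_preimage coor (\bigcup_i F i).
Proof. exact: sigma_algebra_bigcup. Qed.

HB.instance Definition _ := @isMeasurable.Build (measure_cV_display d)
  'cV[T]_n (g_sigma_preimage coor) cV_set0 cV_setC cV_bigcup.

Lemma measurable_coor (i : 'I_n) :
  measurable_fun [set: 'cV[T]_n] (fun x : 'cV[T]_n => x i ord0).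
Proof.
move=> _ Y mY; rewrite setTI; apply: sub_sigma_algebra => /=.
rewrite -bigcup_seq/=; exists i => /=; first by rewrite mem_index_enum.
by exists Y => //; rewrite setTI.
Qed.

Lemma measurable_fun_cVP d' (S : measurableType d') (f : S -> 'cV[T]_n) :
  (forall i, measurable_fun [set: S] (fun s => f s i ord0)) ->
  measurable_fun [set: S] f.
Proof.
move=> mf; apply: (@measurability _ _ _ _ _ _
  (\big[setU/set0]_(i < n) preimage_set_system setT (coor i) measurable)) => //.
move=> _ [B + <-]; rewrite -bigcup_seq/= => -[i _ [C mC <-]].
by rewrite (setTI (_ @^-1` C)); exact: mf.
Qed.

End measurable_cV.

Definition cons_cV (T : Type) (n : nat) (p : T * 'cV[T]_n) : 'cV[T]_n.+1 :=
  col_mx (const_mx p.1 : 'cV[T]_1) p.2.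

Lemma cons_cV0 (T : Type) n (p : T * 'cV[T]_n) : cons_cV p ord0 ord0 = p.1.
Proof.
have e : (ord0 : 'I_(1 + n)) = lshift n ord0 by exact: val_inj.
transitivity ((col_mx (const_mx p.1 : 'cV[T]_1) p.2) (lshift n ord0) ord0).
  by rewrite -e.
by rewrite col_mxEu mxE.
Qed.

Lemma cons_cVS (T : Type) n (p : T * 'cV[T]_n) (i : 'I_n) :
  cons_cV p (lift ord0 i) ord0 = p.2 i ord0.
Proof.
have e : (lift ord0 i : 'I_(1 + n)) = rshift 1 i by exact: val_inj.
transitivity ((col_mx (const_mx p.1 : 'cV[T]_1) p.2) (rshift 1 i) ord0).
  by rewrite -e.
by rewrite col_mxEd.
Qed.

Lemma measurable_cons_cV d (T : measurableType d) n :
  measurable_fun setT (@cons_cV T n).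
Proof.
apply: measurable_fun_cVP => i; case: (unliftP ord0 i) => [j|] ->.
- rewrite (_ : (fun s => _) = (fun x : 'cV[T]_n => x j ord0) \o snd).
    by apply: measurableT_comp => //; exact: measurable_coor.
  by apply/funext => p; rewrite cons_cVS.
- by rewrite (_ : (fun s => _) = fst)//; apply/funext => p; rewrite cons_cV0.
Qed.

Definition uncons_cV (T : Type) (n : nat) (x : 'cV[T]_n.+1) : T * 'cV[T]_n :=
  (x ord0 ord0, \col_i x (lift ord0 i) ord0).

Lemma cons_cVK (T : Type) n : cancel (@cons_cV T n) (@uncons_cV T n).
Proof.
move=> [a x]; rewrite /uncons_cV cons_cV0; congr (_, _).
by apply/colP => i; rewrite mxE cons_cVS.
Qed.

Lemma measurable_uncons_cV d (T : measurableType d) n :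
  measurable_fun setT (@uncons_cV T n).
Proof.
apply: measurable_fun_pair; first exact: measurable_coor.
apply: measurable_fun_cVP => i.
under eq_fun do rewrite mxE.
exact: measurable_coor.
Qed.

Section lebesgue_cV.
Context {R : realType}.

(* Lebesgue measure on R^n, as the n-fold product of the Lebesgue measure
   on R (a unit point mass when n = 0). *)
Fixpoint lebesgue_cV (n : nat) : set 'cV[R]_n -> \bar R :=
  match n with
  | 0 => dirac (0 : 'cV[R]_0)
  | m.+1 => pushforward (lebesgue_measure \x @lebesgue_cV m)%E (@cons_cV R m)
  end.

Let lebesgue_cVP n :
  exists m : {sigma_finite_measure set 'cV[R]_n -> \bar R}, @lebesgue_cV n = m.
Proof.
elim: n => [|n [m lm]].
  pose m0 : {sigma_finite_measure set 'cV[R]_0 -> \bar R} :=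
    (dirac (0 : 'cV[R]_0) : {finite_measure set 'cV[R]_0 -> \bar R}).
  by exists m0.
have mc : measurable_fun [set: measurableTypeR R * 'cV[R]_n]
    (@cons_cV R n : _ -> 'cV[R]_n.+1) by exact: (@measurable_cons_cV _ R n).
pose p : {measure set 'cV[R]_n.+1 -> \bar R} :=
  measure_function_pushforward__canonical__measure_function_Measure
    (lebesgue_measure \x m)%E mc.
have sp : sigma_finite setT p.
  have /sigma_finiteP[F [TF ndF Foo]] := sigma_finiteT (@lebesgue_measure R).
  have /sigma_finiteP[G [TG ndG Goo]] := sigma_finiteT m.
  exists (fun k => @uncons_cV R n @^-1` (F k `*` G k)).
    rewrite -preimage_bigcup (_ : \bigcup_k _ = setT) ?preimage_setT//.
    apply/seteqP; split => // -[x y] _.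
    have [i _ Fix] : (\bigcup_i F i) x by rewrite -TF.
    have [j _ Gjy] : (\bigcup_i G i) y by rewrite -TG.
    exists (maxn i j) => //; split.
    - by move: x Fix; exact/subsetPset/ndF/leq_maxl.
    - by move: y Gjy; exact/subsetPset/ndG/leq_maxr.
  move=> k; have [mF Fkoo] := Foo k; have [mG Gkoo] := Goo k; split.
    rewrite -[X in measurable X]setTI; apply: measurable_uncons_cV => //.
    exact: measurableX.
  rewrite /p/= /pushforward -comp_preimage (_ : _ \o _ = id); last first.
    exact/funext/cons_cVK.
  by rewrite preimage_id product_measure1E// lte_mul_pinfty// ge0_fin_numE.
pose q : {sigma_finite_measure set 'cV[R]_n.+1 -> \bar R} :=
  HB.pack (Measure.sort p) p (Measure_isSigmaFinite.Build _ _ _ _ sp).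
by exists q => /=; rewrite lm.
Qed.

Variable n : nat.

Let lebesgue_cV_set0 : @lebesgue_cV n set0 = 0%E.
Proof. by have [m ->] := lebesgue_cVP n; exact: measure0. Qed.

Let lebesgue_cV_ge0 A : (0 <= @lebesgue_cV n A)%E.
Proof. by have [m ->] := lebesgue_cVP n; exact: measure_ge0. Qed.

Let lebesgue_cV_sigma_additive : semi_sigma_additive (@lebesgue_cV n).
Proof.
by have [m ->] := lebesgue_cVP n; exact: measure_semi_sigma_additive.
Qed.

HB.instance Definition _ := isMeasure.Build _ _ _ (@lebesgue_cV n)
  lebesgue_cV_set0 lebesgue_cV_ge0 lebesgue_cV_sigma_additive.

Let lebesgue_cV_sigma_finite : sigma_finite setT (@lebesgue_cV n).
Proof. by have [m ->] := lebesgue_cVP n; exact: sigma_finiteT. Qed.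

HB.instance Definition _ := Measure_isSigmaFinite.Build _ _ _
  (@lebesgue_cV n) lebesgue_cV_sigma_finite.

End lebesgue_cV.
Arguments lebesgue_cV {R} n.

Lemma lebesgue_cV_box (R : realType) n (A : 'I_n -> set R) :
  (forall i, measurable (A i)) ->
  lebesgue_cV n [set x : 'cV[R]_n | forall i, A i (x i ord0)] =
  (\prod_(i < n) lebesgue_measure (A i))%E.
Proof.
elim: n A => [|n IH] A mA.
  by rewrite big_ord0 /= diracE mem_set// => -[].
rewrite big_ord_recl -IH; last by move=> i; exact: mA.
rewrite /= /pushforward -product_measure1E; last 2 first.
- exact: mA.
- rewrite (_ : [set x | _] =
      \bigcap_(i in [set: 'I_n]) (fun x : 'cV[R]_n => x i ord0)
        @^-1` A (lift ord0 i)); last first.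
    by apply/seteqP; split => x /= h i => [_|]; exact: h.
  apply: fin_bigcap_measurable => // i _.
  by rewrite -[X in measurable X]setTI; exact: measurable_coor.
congr (product_measure1 _ _ _); apply/seteqP; split => -[a x] /=.
- move=> h; split => [|i]; first by have := h ord0; rewrite cons_cV0.
  by have := h (lift ord0 i); rewrite cons_cVS.
- move=> [h0 h] i; case: (unliftP ord0 i) => [j|] ->.
  + by rewrite cons_cVS; exact: h.
  + by rewrite cons_cV0.
Qed.

Section densities.
Context {R : realType}.

(* [has_density P mu X f]: the law of X under P has density f with respect
   to mu. *)
Definition has_density d d' (T : measurableType d) (T' : measurableType d')
    (P : probability T R) (mu : {measure set T' -> \bar R})
    (X : T -> T') (f : T' -> R) : Prop :=
  [/\ measurable_fun [set: T] X,
      measurable_fun [set: T'] f,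
      forall z, 0 <= f z
    & forall A, measurable A ->
        P (X @^-1` A) = (\int[mu]_(z in A) (f z)%:E)%E].

Definition independent_RV d d1 d2 (T : measurableType d)
    (T1 : measurableType d1) (T2 : measurableType d2) (P : probability T R)
    (X : {RV P >-> T1}) (Y : {RV P >-> T2}) : Prop :=
  forall A B, measurable A -> measurable B ->
    P (X @^-1` A `&` Y @^-1` B) = (P (X @^-1` A) * P (Y @^-1` B))%E.

Definition dotv n (u v : 'cV[R]_n) : R := (u^T *m v) ord0 ord0.

Definition posdef n (S : 'M[R]_n) : Prop :=
  S^T = S /\ forall v : 'cV[R]_n, v != 0 -> 0 < dotv v (S *m v).

(* Density of N_n(0, Omega). *)
Definition mvnormal_pdf n (Omega : 'M[R]_n) (z : 'cV[R]_n) : R :=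
  (Num.sqrt ((2 * pi) ^+ n * \det Omega))^-1 *
  expR (- dotv z (invmx Omega *m z) / 2).

Definition rayleigh_pdf (u : R) : R :=
  if 0 <= u then u * expR (- u ^+ 2 / 2) else 0.

Definition std_normal_pdf (t : R) : R := normal_pdf 0 1 t.

Definition std_normal_cdf (t : R) : R := fine (normal_prob 0 1 `]-oo, t]).

Definition inv_mills (t : R) : R := std_normal_pdf t / std_normal_cdf t.

End densities.

(* Main.v *)
Require Import Defs.
From HB Require Import structures.
From mathcomp Require Import all_boot all_order all_algebra.
From mathcomp Require Import all_classical all_reals all_analysis.
From mathcomp Require Import measurable_realfun ring.

Set Implicit Arguments.
Unset Strict Implicit.
Unset Printing Implicit Defensive.

Import Order.TTheory GRing.Theory Num.Theory.
Import numFieldNormedType.Exports.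

Local Open Scope classical_set_scope.
Local Open Scope ring_scope.

(** The law of Z = U gamma + X is a mixture: given U = u, Z is normal with mean
u gamma and covariance Sigma. Its density at z is therefore
int_0^oo u exp(- u^2 / 2) phi_d(z - u gamma; Sigma) du, and the theorem is the
closed form of this integral.

The mixture formula ([has_density_random_shift]) holds for any independent U
and X with densities g and f. Independence makes g(u) f(x) the joint density
([joint_has_density]), since a measure on a product is determined by its values
on rectangles; the translation x = z - u gamma, which preserves Lebesgue measure
([ge0_integral_lebesgue_cV_translate]), and Tonelli's theorem then bring the
integration over z outside.

To evaluate the integral, put k = sqrt (1 + alpha^2) and t = eta^T z, so that
k t = gamma^T Sigma^-1 z. The Sherman-Morrison formula for Omega^-1 turns the
total exponent into a completed square ([mahalanobis_rank1]),
  u^2 + (z - u gamma)^T Sigma^-1 (z - u gamma)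
    = z^T Omega^-1 z + (k u - t)^2,
and the determinant identity det Omega = k^2 det Sigma matches the normalising
constants. What remains is the one-dimensional integral
  int_0^oo k^2 u exp(- (k u - t)^2 / 2) du
    = exp(- t^2 / 2) + t sqrt(2 pi) Phi(t)
([integral_shifted_gauss_moment]), whose right-hand side is
sqrt(2 pi) (phi(t) + t Phi(t)) = sqrt(2 pi) Phi(t) (zeta(t) + t). *)

(** * Rank-one updates of positive definite matrices *)

Section linear_algebra.
Context {F : comUnitRingType}.

(** Block elimination: the block matrix with rows (1 + v u, v) and (0, 1),
multiplied on both sides by block unitriangular matrices, becomes the one with
rows (1, v) and (0, 1 + u v). *)
Lemma det_rank1_update n (u : 'cV[F]_n) (v : 'rV[F]_n) :
  \det (1%:M + u *m v) = 1 + (v *m u) ord0 ord0.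
Proof.
have e : block_mx (1%:M : 'M[F]_1) 0 u 1%:M *m block_mx (1%:M + v *m u) v 0 1%:M
    *m block_mx 1%:M 0 (- u) 1%:M = block_mx 1%:M v 0 (1%:M + u *m v).
  rewrite !mulmx_block !mul1mx !mul0mx !mulmx1 !mulmx0 !addr0 ?add0r.
  rewrite !mulmxDr !mulmxDl !mulmxN !mulmx1 !mulmxA !mul1mx addrK.
  by rewrite [u *m v + _]addrC -opprD [_ *m u + u]addrC subrr.
have := congr1 determinant e.
rewrite !det_mulmx !det_lblock !det_ublock !det1 !mul1r !mulr1 => <-.
by rewrite det_mx11 !mxE eqxx.
Qed.

End linear_algebra.

Section posdef.
Context {R : realType} {n : nat}.
Implicit Types (u v w z gamma : 'cV[R]_n) (M S Sigma : 'M[R]_n).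

Lemma dotvE u v : dotv u v = \sum_i u i ord0 * v i ord0.
Proof. by rewrite /dotv mxE; apply: eq_bigr => i _; rewrite mxE. Qed.

Lemma dotvC u v : dotv u v = dotv v u.
Proof. by rewrite !dotvE; apply: eq_bigr => i _; rewrite mulrC. Qed.

Lemma dotvDr u v w : dotv u (v + w) = dotv u v + dotv u w.
Proof. by rewrite /dotv mulmxDr mxE. Qed.

Lemma dotvZr c u v : dotv u (c *: v) = c * dotv u v.
Proof. by rewrite /dotv -scalemxAr mxE. Qed.

Lemma dotvZl c u v : dotv (c *: u) v = c * dotv u v.
Proof. by rewrite dotvC dotvZr dotvC. Qed.

Lemma dotv_mulmxl M u v : dotv (M *m u) v = dotv u (M^T *m v).
Proof. by rewrite /dotv trmx_mul mulmxA. Qed.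

Lemma mul_outer u v w : u *m v^T *m w = dotv v w *: u.
Proof.
rewrite -mulmxA; apply/colP => i; rewrite !mxE big_ord1 mulrC.
by congr (_ * _).
Qed.

Lemma posdef_unitmx Sigma : posdef Sigma -> Sigma \in unitmx.
Proof.
move=> [ST Spos]; rewrite -unitmx_tr -row_free_unit -kermx_eq0.
apply/eqP/row_matrixP => i; rewrite row0.
apply/eqP/negP => /negP k0.
have := Spos (row i (kermx Sigma^T))^T.
rewrite trmx_eq0 => /(_ k0).
suff -> : Sigma *m (row i (kermx Sigma^T))^T = 0 by rewrite /dotv mulmx0 mxE ltxx.
by apply: trmx_inj; rewrite trmx_mul trmxK trmx0 -row_mul mulmx_ker row0.
Qed.

Lemma posdef_invmx_tr Sigma : posdef Sigma -> (invmx Sigma)^T = invmx Sigma.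
Proof. by move=> [ST _]; rewrite trmx_inv ST. Qed.

Lemma posdef_invmx_ge0 Sigma v :
  posdef Sigma -> 0 <= dotv v (invmx Sigma *m v).
Proof.
move=> Sp; have Su := posdef_unitmx Sp; have [ST Spos] := Sp.
have [->|v0] := eqVneq v 0; first by rewrite mulmx0 /dotv mulmx0 mxE.
have w0 : invmx Sigma *m v != 0.
  by apply: contra_neq v0 => w0; rewrite -(mulKVmx Su v) w0 mulmx0.
by have := Spos _ w0; rewrite mulKVmx// dotvC => /ltW.
Qed.

Lemma det_posdef_rank1 Sigma gamma : posdef Sigma ->
  \det (Sigma + gamma *m gamma^T) =
  \det Sigma * (1 + dotv gamma (invmx Sigma *m gamma)).
Proof.
move=> /posdef_unitmx Su.
rewrite (_ : _ + _ = Sigma *m (1%:M + invmx Sigma *m gamma *m gamma^T)); last first.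
  by rewrite mulmxDr mulmx1 -!mulmxA mulKVmx.
by rewrite det_mulmx det_rank1_update.
Qed.

(** The Sherman-Morrison formula, applied to a vector so that no product of
inverse matrices has to be formed. *)
Lemma invmx_posdef_rank1 Sigma gamma z : posdef Sigma ->
  let a2 := dotv gamma (invmx Sigma *m gamma) in
  invmx (Sigma + gamma *m gamma^T) *m z =
  invmx Sigma *m z +
    (- (dotv gamma (invmx Sigma *m z) / (1 + a2))) *: (invmx Sigma *m gamma).
Proof.
move=> Sp a2; have Su := posdef_unitmx Sp.
have a20 : 1 + a2 != 0 by rewrite gt_eqF// ltr_pwDl// posdef_invmx_ge0.
have Ou : Sigma + gamma *m gamma^T \in unitmx.
  rewrite unitmxE det_posdef_rank1// unitrM -unitmxE Su/=.
  by rewrite unitfE.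
apply: (can_inj (mulKmx Ou)); rewrite mulKVmx//.
rewrite mulmxDl mulmxDr mulKVmx// -scalemxAr mulKVmx// mul_outer.
set b := dotv gamma (_ *m z); set c := b / _.
have cE : b = c * (1 + a2) by rewrite divfK.
clearbody c.
rewrite dotvDr dotvZr -/a2 -/b.
(* The coefficient of gamma is - c + (b - c a2), zero by the choice of c. *)
rewrite -addrA -scalerDl.
rewrite (_ : - c + _ = 0) ?scale0r ?addr0// cE.
by ring.
Qed.

(** Completing the square in u. With b = gamma^T Sigma^-1 z, the left-hand side
is z^T Sigma^-1 z - 2 u b + k^2 u^2, and the Sherman-Morrison formula identifies
z^T Sigma^-1 z - b^2 / k^2 with the quadratic form of the updated matrix. *)
Lemma mahalanobis_rank1 Sigma gamma z (u : R) : posdef Sigma ->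
  let a2 := dotv gamma (invmx Sigma *m gamma) in
  let k := Num.sqrt (1 + a2) in
  let t := dotv (k^-1 *: (invmx Sigma *m gamma)) z in
  u ^+ 2 + dotv (z - u *: gamma) (invmx Sigma *m (z - u *: gamma)) =
  dotv z (invmx (Sigma + gamma *m gamma^T) *m z) + (k * u - t) ^+ 2.
Proof.
move=> Sp a2 k t; have iT := posdef_invmx_tr Sp.
have a20 : 0 < 1 + a2 by rewrite ltr_pwDl// posdef_invmx_ge0.
have k0 : k != 0 by rewrite gt_eqF// sqrtr_gt0.
have k2 : 1 + a2 = k ^+ 2 by rewrite sqr_sqrtr// ltW.
rewrite invmx_posdef_rank1// -/a2 -(scaleNr u) mulmxDr -scalemxAr.
rewrite !dotvDr !dotvZr.
rewrite !(dotvC (_ + _)) !dotvDr !dotvZr.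
rewrite /t dotvZl dotv_mulmxl iT.
rewrite !dotv_mulmxl iT -/a2 (_ : a2 = k ^+ 2 - 1); last by rewrite -k2; ring.
rewrite (dotvC z (_ *m gamma)) dotv_mulmxl iT.
set b := dotv gamma _; set q := dotv z _.
have D0 : 1 + (k ^+ 2 - 1) != 0 by rewrite addrC subrK sqrf_eq0.
by field; rewrite ?k0 ?D0.
Qed.

End posdef.

(** * Translation invariance of Lebesgue measure on R^n *)

Section translation.
Context {R : realType}.
Local Open Scope ereal_scope.

Lemma ge0_integral_lebesgue_translate (c : R) (f : R -> \bar R) :
  measurable_fun [set: R] f -> (forall x, 0 <= f x) ->
  \int[lebesgue_measure]_x f (x + c)%R = \int[lebesgue_measure]_x f x.
Proof.
move=> mf f0.
have mc : measurable_fun [set: measurableTypeR R]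
    ((fun x => x + c)%R : _ -> measurableTypeR R) by exact: measurable_funD.
have := @ge0_integral_pushforward _ _ (measurableTypeR R) (measurableTypeR R)
  _ _ mc lebesgue_measure setT f
  measurableT mf (fun x _ => f0 x).
rewrite preimage_setT => <-.
apply: eq_measure_integral => //= A mA _; apply/esym.
apply: (@lebesgue_measure_unique _ (pushforward lebesgue_measure
  ((fun x => x + c)%R : measurableTypeR R -> measurableTypeR R))) => //= _ [[a b]] _ <-.
rewrite /pushforward (_ : _ @^-1` _ = `](a - c)%R, (b - c)%R]%classic); last first.
  by apply/seteqP; split => x/=; rewrite !in_itv/= ltrBlDr lerBrDr.
by rewrite !lebesgue_measure_itv/= !lte_fin ltrD2r -!EFinD opprD addrACA subrr addr0.
Qed.

Lemma measurable_addv n (c : 'cV[R]_n) :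
  measurable_fun [set: 'cV[R]_n] (fun x => x + c)%R.
Proof.
apply: measurable_fun_cVP => i; under eq_fun do rewrite mxE.
by apply: measurable_funD => //; exact: measurable_coor.
Qed.

(** Tonelli's theorem for the first coordinate; it makes induction on the
dimension possible. *)
Lemma ge0_integral_lebesgue_cVS n (f : 'cV[R]_n.+1 -> \bar R) :
  measurable_fun setT f -> (forall x, 0 <= f x) ->
  \int[lebesgue_cV n.+1]_x f x =
  \int[lebesgue_measure]_a \int[lebesgue_cV n]_y f (cons_cV (a, y)).
Proof.
move=> mf f0.
have mc : measurable_fun [set: measurableTypeR R * 'cV[R]_n]
    (@cons_cV R n : _ -> 'cV[R]_n.+1) by exact: (@measurable_cons_cV _ R n).
rewrite -(@fubini_tonelli1 _ _ _ _ _ lebesgue_measure (lebesgue_cV n)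
  (f \o @cons_cV R n))//=; last first.
  exact: measurableT_comp.
have := @ge0_integral_pushforward _ _ _ _ _ _ mc
  (lebesgue_measure \x lebesgue_cV n) setT f measurableT mf (fun x _ => f0 x).
rewrite preimage_setT => <-.
exact: eq_measure_integral.
Qed.

(** By induction on the dimension, translating first the last coordinates and
then the first one. *)
Lemma ge0_integral_lebesgue_cV_translate n (c : 'cV[R]_n) (f : 'cV[R]_n -> \bar R) :
  measurable_fun setT f -> (forall x, 0 <= f x) ->
  \int[lebesgue_cV n]_x f (x + c)%R = \int[lebesgue_cV n]_x f x.
Proof.
elim: n c f => [|n IH] c f mf f0.
  by apply: eq_integral => x _; congr f; apply/colP => -[].
have mcons : measurable_fun [set: measurableTypeR R * 'cV[R]_n]
    (@cons_cV R n : _ -> 'cV[R]_n.+1) by exact: (@measurable_cons_cV _ R n).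
pose c' : 'cV[R]_n := (\col_i c (lift ord0 i) ord0)%R.
have consD a y : (cons_cV (a, y) + c = cons_cV (a + c ord0 ord0, y + c'))%R.
  apply/colP => i; rewrite mxE; case: (unliftP ord0 i) => [j|] ->.
    by rewrite !cons_cVS/= !mxE.
  by rewrite !cons_cV0.
have mfcons : measurable_fun [set: measurableTypeR R * 'cV[R]_n] (f \o @cons_cV R n).
  exact: measurableT_comp.
rewrite !ge0_integral_lebesgue_cVS//; last first.
  apply: (measurableT_comp mf); exact: measurable_addv.
under eq_integral => a _.
  under eq_integral do rewrite consD.
  rewrite (IH c' (fun y => f (cons_cV ((a + c ord0 ord0)%R, y))))//; last first.
    apply: (measurableT_comp mfcons); exact: pair1_measurable.
  over.
rewrite (ge0_integral_lebesgue_translate (c ord0 ord0)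
  (f := fun a => \int[lebesgue_cV n]_y f (cons_cV (a, y))))//.
- exact: (@measurable_fun_fubini_tonelli_F _ _ _ _ _ (lebesgue_cV n) _ mfcons
    (fun p => f0 _)).
- by move=> a; exact: integral_ge0.
Qed.

End translation.

(** * Joint densities and random shifts *)

Section joint_density.
Context {R : realType}.
Local Open Scope ereal_scope.

Lemma integral_EFin_indic d (T : measurableType d)
    (mu : {measure set T -> \bar R}) (D : set T) (f : T -> R) :
  \int[mu]_(x in D) (f x)%:E = \int[mu]_x (f x * \1_D x)%:E.
Proof.
rewrite integral_mkcond; apply: eq_integral => x _.
by rewrite patchE indicE; case: (x \in D); rewrite ?mulr1 ?mulr0.
Qed.

(** Integration against a density is made into a measure so that it can be
compared with other measures on generating sets. *)
Lemma density_measure_exists d (T : measurableType d)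
    (mu : {measure set T -> \bar R}) (h : T -> R) :
  measurable_fun [set: T] h -> (forall x, 0 <= h x)%R ->
  exists nu : {measure set T -> \bar R},
    forall A, nu A = \int[mu]_(x in A) (h x)%:E.
Proof.
move=> mh h0; pose Q A := \int[mu]_(x in A) (h x)%:E.
have Q0 : Q set0 = 0 by rewrite /Q integral_set0.
have Qge0 A : 0 <= Q A by apply: integral_ge0 => x _; rewrite lee_fin.
have Qsigma : semi_sigma_additive Q.
  move=> F mF tF mUF; rewrite /Q ge0_integral_bigcup//; last 2 first.
  - by apply/measurable_EFinP; exact: measurable_funTS.
  - by move=> x _; rewrite lee_fin.
  by apply: is_cvg_ereal_nneg_natsum_cond => n _ _; exact: Qge0.
pose nu : {measure set T -> \bar R} :=
  HB.pack Q (isMeasure.Build _ _ _ Q Q0 Qge0 Qsigma).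
by exists nu.
Qed.

(** The law of the pair and the measure of density f(x) g(y) both agree on
rectangles with the product of the two laws, hence everywhere: independence
gives the first equality, Tonelli's theorem the second. Independence is a
product rule on plain functions because Lebesgue measure and real random
variables carry convertible sigma-algebras on R with different displays. *)
Lemma joint_has_density d d1 d2 (T : measurableType d)
    (T1 : measurableType d1) (T2 : measurableType d2) (P : probability T R)
    (m1 : {sigma_finite_measure set T1 -> \bar R})
    (m2 : {sigma_finite_measure set T2 -> \bar R})
    (X : T -> T1) (Y : T -> T2) (f : T1 -> R) (g : T2 -> R) :
  has_density P m1 X f -> has_density P m2 Y g ->
  (forall A B, measurable A -> measurable B ->
    P (X @^-1` A `&` Y @^-1` B) = P (X @^-1` A) * P (Y @^-1` B)) ->
  has_density P (m1 \x m2) (fun w => (X w, Y w)) (fun p => f p.1 * g p.2)%R.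
Proof.
move=> [mX mf f0 Xf] [mY mg g0 Yg] XY.
have mXY : measurable_fun [set: T] (fun w => (X w, Y w)).
  exact: measurable_fun_pair.
have mfg : measurable_fun [set: T1 * T2] (fun p => f p.1 * g p.2)%R.
  by apply: measurable_funM; exact: measurableT_comp.
have fg0 (p : T1 * T2) : (0 <= f p.1 * g p.2)%R by rewrite mulr_ge0.
split => // B mB.
have [nu nuE] := density_measure_exists (m1 \x m2) mfg fg0.
pose Xm : {mfun T >-> T1} := HB.pack X (isMeasurableFun.Build _ _ _ _ _ mX).
pose Ym : {mfun T >-> T2} := HB.pack Y (isMeasurableFun.Build _ _ _ _ _ mY).
pose XYm : {mfun T >-> (T1 * T2)%type} :=
  HB.pack (fun w => (X w, Y w)) (isMeasurableFun.Build _ _ _ _ _ mXY).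
transitivity ((distribution P Xm \x distribution P Ym) B).
  apply/esym; apply: (@product_measure_unique _ _ _ _ _ (distribution P Xm)
    (distribution P Ym) (distribution P XYm)) => //.
rewrite -nuE.
apply: (@product_measure_unique _ _ _ _ _ (distribution P Xm) (distribution P Ym)) => //.
move=> A C mA mC; rewrite nuE.
transitivity (\int[m1]_(x in A) (f x)%:E * \int[m2]_(y in C) (g y)%:E); last first.
  by rewrite -Xf// -Yg.
rewrite (integral_EFin_indic _ (A `*` C)) (integral_EFin_indic _ A).
rewrite (integral_EFin_indic _ C).
have mfA : measurable_fun [set: T1] (fun x => f x * \1_A x)%R.
  by apply: measurable_funM => //; exact: measurable_indic.
have mgC : measurable_fun [set: T2] (fun x => g x * \1_C x)%R.
  by apply: measurable_funM => //; exact: measurable_indic.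
under eq_integral => p _.
  rewrite (_ : _ * _ = (f p.1 * \1_A p.1) * (g p.2 * \1_C p.2))%R; last first.
    by rewrite !indicE in_setX mulrACA -natrM mulnb.
  over.
rewrite fubini_tonelli1//=; last 2 first.
- apply/measurable_EFinP; apply: measurable_funM.
  + exact: (measurableT_comp mfA).
  + exact: (measurableT_comp mgC).
- by move=> p; rewrite lee_fin !mulr_ge0.
rewrite /fubini_F/=.
under eq_integral => x _.
  under eq_integral do rewrite EFinM.
  rewrite ge0_integralZl//; last 3 first.
  - exact/measurable_EFinP.
  - by move=> y _; rewrite lee_fin mulr_ge0.
  - by rewrite lee_fin mulr_ge0.
  over.
rewrite ge0_integralZr//.
- exact/measurable_EFinP.
- by move=> x _; rewrite lee_fin mulr_ge0.
- by apply: integral_ge0 => y _; rewrite lee_fin mulr_ge0.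
Qed.

End joint_density.

Section random_shift.
Context {R : realType}.

Lemma measurable_scalev_add n (gamma : 'cV[R]_n) :
  measurable_fun [set: measurableTypeR R * 'cV[R]_n]
    (fun p => p.1 *: gamma + p.2 : 'cV[R]_n).
Proof.
apply: measurable_fun_cVP => i; under eq_fun do rewrite !mxE.
apply: measurable_funD.
  by apply: measurable_funM => //; exact: measurable_fst.
by apply: (measurableT_comp (measurable_coor i)); exact: measurable_snd.
Qed.

(** Applying the joint density of (U, X) to the event U gamma + X \in A gives an
integral over (u, x); the substitution x = z - u gamma at fixed u and an
exchange of integrals leave the integral over z in A of fZ. As a parameter
integral of a nonnegative measurable function, fZ is measurable and nonnegative. *)
Lemma has_density_random_shift d (T : measurableType d) (P : probability T R) n
    (gamma : 'cV[R]_n) (U : {RV P >-> R}) (X : {RV P >-> 'cV[R]_n})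
    (g : R -> R) (f fZ : 'cV[R]_n -> R) :
  has_density P lebesgue_measure U g -> has_density P (lebesgue_cV n) X f ->
  independent_RV U X ->
  (forall z, (\int[lebesgue_measure]_u (g u * f (z - u *: gamma)%R)%:E)%E =
    (fZ z)%:E) ->
  has_density P (lebesgue_cV n) (fun w => U w *: gamma + X w) fZ.
Proof.
move=> Ug Xf UX fZE.
have [_ mg g0 _] := Ug; have [_ mf f0 _] := Xf.
have [mUX mgf _ UXgf] :=
  @joint_has_density _ _ _ _ _ (measurableTypeR R) _ P
    lebesgue_measure (lebesgue_cV n) U X g f Ug Xf UX.
have mS := measurable_scalev_add gamma.
pose h (p : measurableTypeR R * 'cV[R]_n) := g p.1 * f (p.2 - p.1 *: gamma).
have mh : measurable_fun setT h.
  apply: measurable_funM.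
    by apply: (measurableT_comp mg); exact: measurable_fst.
  apply: (measurableT_comp mf); under eq_fun do rewrite addrC -scalerN.
  exact: measurable_scalev_add.
have h0 p : 0 <= h p by rewrite mulr_ge0.
split.
- exact: (measurableT_comp mS mUX).
- apply/measurable_EFinP.
  rewrite (_ : _ \o _ = fubini_G lebesgue_measure (EFin \o h)); last first.
    by apply/funext => z; rewrite /= -fZE.
  apply: measurable_fun_fubini_tonelli_G; first exact/measurable_EFinP.
  by move=> p; rewrite lee_fin.
- move=> z; rewrite -lee_fin -fZE; apply: integral_ge0 => u _.
  by rewrite lee_fin mulr_ge0.
move=> A mA.
pose B := (fun p : measurableTypeR R * 'cV[R]_n => p.1 *: gamma + p.2) @^-1` A.
have mB : measurable B by rewrite -[B]setTI; exact: mS.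
rewrite [LHS](UXgf B mB) (integral_EFin_indic _ B) (integral_EFin_indic _ A).
rewrite fubini_tonelli1/=; last 2 first.
- by apply/measurable_EFinP; apply: measurable_funM => //.
- by move=> p; rewrite lee_fin !mulr_ge0.
rewrite /fubini_F/=.
pose hA (p : measurableTypeR R * 'cV[R]_n) := (h p * \1_A p.2)%:E.
have mhA : measurable_fun setT hA.
  apply/measurable_EFinP; apply: measurable_funM => //.
  by apply: (measurableT_comp (measurable_indic mA)); exact: measurable_snd.
have hA0 p : (0 <= hA p)%E by rewrite lee_fin !mulr_ge0.
transitivity (\int[lebesgue_measure]_u \int[lebesgue_cV n]_z hA (u, z))%E.
  apply: eq_integral => u _.
  rewrite -(ge0_integral_lebesgue_cV_translate (u *: gamma)
    (f := fun z => hA (u, z)))//; last exact: measurableT_comp.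
  apply: eq_integral => x _; rewrite /hA /h/= addrK addrC.
  by rewrite !indicE /B.
rewrite (fubini_tonelli (m2 := lebesgue_cV n) _ mhA hA0).
apply: eq_integral => z _; rewrite EFinM -fZE -ge0_integralZr//.
- apply/measurable_EFinP; exact: (measurableT_comp mh (pair2_measurable z)).
- by move=> u _; rewrite lee_fin mulr_ge0.
Qed.

End random_shift.

(** * The one-dimensional Gaussian integral *)

Section std_normal.
Context {R : realType}.
Notation mu := (@lebesgue_measure R).
Notation phi := (@std_normal_pdf R).
Notation Phi := (@std_normal_cdf R).

Lemma std_normal_pdfE t : phi t = (Num.sqrt (2 * pi))^-1 * expR (- t ^+ 2 / 2).
Proof.
rewrite /std_normal_pdf normal_pdfE ?oner_eq0// /normal_peak /normal_fun.
by rewrite subr0 expr1n mul1r mulr_natl.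
Qed.

Lemma std_normal_pdf_gt0 t : 0 < phi t.
Proof.
by rewrite std_normal_pdfE mulr_gt0 ?expR_gt0// invr_gt0 sqrtr_gt0 mulr_gt0// pi_gt0.
Qed.

Lemma continuous_std_normal_pdf : continuous phi.
Proof. by apply: continuous_normal_pdf; rewrite oner_eq0. Qed.

Lemma is_derive_std_normal_cdf (t : R) : is_derive t 1 Phi (phi t).
Proof.
have t1 : t < t + 1 by rewrite ltrDl.
have iphi : mu.-integrable [set` Interval -oo%O (BRight (t + 1))] (EFin \o phi).
  by apply: (integrableS _ _ (subsetT _)) => //; exact: integrable_normal_pdf.
have [||d dE] := continuous_FTC1 t1 iphi.
  by rewrite ltNyr.
  exact: continuous_std_normal_pdf.
by split; [exact: d|rewrite -derive1E; exact: dE].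
Qed.

(** Phi is nonnegative and, having a positive derivative, strictly increasing,
so it cannot vanish. *)
Lemma std_normal_cdf_gt0 t : 0 < Phi t.
Proof.
suff: Phi (t - 1) < Phi t.
  by apply: le_lt_trans; rewrite fine_ge0.
have dPhi x : derivable Phi x 1 by have [] := is_derive_std_normal_cdf x.
apply: (@gtr0_derive1_lt_cc _ Phi (t - 1) t) => //.
- move=> x _; rewrite derive1E; have [_ ->] := is_derive_std_normal_cdf x.
  exact: std_normal_pdf_gt0.
- apply: derivable_within_continuous => x _; exact: dPhi.
- by rewrite in_itv/= gerBl ler01 lexx.
- by rewrite in_itv/= gerBl ler01 lexx.
- by rewrite gtrBl ltr01.
Qed.

Lemma cvg_std_normal_cdfNy : Phi x @[x --> -oo] --> (0 : R).
Proof.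
pose idT : measurableTypeR R -> R := idfun.
pose Id : {mfun measurableTypeR R >-> R} := HB.pack idT
  (@isMeasurableFun.Build _ _ _ _ idT (@measurable_id _ _ setT)).
have /fine_cvg := @cvg_cdfNy0 _ _ _ (normal_prob (0 : R) 1) Id.
exact.
Qed.

(** The integrand is k ((k u - t) + t) exp(- (k u - t)^2 / 2), so
- exp(- (k u - t)^2 / 2) - t sqrt(2 pi) Phi(t - k u) is an antiderivative.
Writing Phi(t - k u) rather than Phi(k u - t) makes it vanish at infinity and
take the value - exp(- t^2 / 2) - t sqrt(2 pi) Phi(t) at 0. *)
Lemma integral_shifted_gauss_moment (k t : R) : 0 < k ->
  (\int[mu]_(u in `[0%R, +oo[) (k ^+ 2 * u * expR (- (k * u - t) ^+ 2 / 2))%:E)%E =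
  (expR (- t ^+ 2 / 2) + t * Num.sqrt (2 * pi) * Phi t)%:E.
Proof.
move=> k0; set c := Num.sqrt (2 * pi).
have c0 : c != 0 by rewrite gt_eqF// sqrtr_gt0 mulr_gt0// pi_gt0.
(* The antiderivative is assembled from operations on functions, the form in
   which the differentiation rules apply. *)
pose l : R -> R := k \*: id - cst t.
pose E : R -> R := expR \o ((- 2^-1) \*: l ^+ 2).
pose G : R -> R := Phi \o - l.
have lE u : l u = k * u - t by [].
pose F : R -> R := - E - (t * c) \*: G.
pose f (u : R) := k ^+ 2 * u * expR (- (k * u - t) ^+ 2 / 2).
have EE u : E u = expR (- (k * u - t) ^+ 2 / 2).
  by rewrite /E /=; congr expR; rewrite /GRing.scale/= mulNr mulrC mulNr.
have FE u : F u = - expR (- (k * u - t) ^+ 2 / 2) - t * c * Phi (t - k * u).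
  by rewrite -EE -[t - k * u]opprB.
have dl (u : R) : is_derive u 1 l k.
  have := is_deriveB (is_deriveZ k (is_derive_id u 1)) (is_derive_cst t u 1).
  by rewrite subr0 /GRing.scale/= mulr1.
have dE (u : R) : is_derive u 1 E (E u * (- 2^-1 * (2 * l u * k))).
  exact: (is_derive1_comp (is_derive_expR _)
    (is_deriveZ (- 2^-1) (is_deriveX 2 (dl u)))).
have dF (u : R) : is_derive u 1 F (f u).
  have dG : is_derive u 1 G (phi (- l u) * - k).
    exact: (@is_derive1_comp _ Phi (- l) _ _ _ (is_derive_std_normal_cdf (- l u))
      (is_deriveN (dl u))).
  apply: is_derive_eq (is_deriveB (is_deriveN (dE u)) (is_deriveZ (t * c) dG)) _.
  rewrite EE std_normal_pdfE /f sqrrN -/c lE /GRing.scale/=.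
  by field.
have FdE u : derivable F u 1 by have [] := dF u.
have cvgl : l u @[u --> +oo] --> +oo.
  under eq_fun do rewrite lE mulrC.
  apply: (cvg_comp (fun u : R => u * k) (fun v => v - t)).
    exact: (gt0_cvgMly k0 cvg_id).
  exact: cvg_addrr.
rewrite (@ge0_continuous_FTC2y _ f F 0 0)//.
- rewrite -EFinB; congr EFin; rewrite FE mulr0 !(sub0r, subr0) sqrrN.
  by rewrite opprD !opprK.
- move=> u u0; apply: mulr_ge0; last exact: expR_ge0.
  by apply: mulr_ge0 => //; exact: sqr_ge0.
- apply: continuous_subspaceT => u.
  have cE : {for u, continuous E}.
    by apply/differentiable_continuous/derivable1_diffP; have [] := dE u.
  rewrite (_ : f = (fun v => k ^+ 2 * v * E v)); last first.
    by apply/funext => v; rewrite EE.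
  apply: (@cvgM _ _ _ _ (fun v => k ^+ 2 * v) E) => //.
  by apply: cvgM; [exact: cvg_cst|exact: cvg_id].
- have cvgE : E u @[u --> +oo] --> (0 : R).
    have {1}-> : E = fun u => expR (- (l u ^+ 2 * 2^-1)).
      by apply/funext => u; rewrite EE lE mulNr.
    apply: (cvg_comp (fun u => l u ^+ 2 * 2^-1) (fun v => expR (- v))).
      apply: gt0_cvgMly; first by rewrite invr_gt0.
      exact: (cvg_comp _ _ cvgl cvgr_expr2).
    exact: cvgr_expR.
  have cvgG : G u @[u --> +oo] --> (0 : R).
    by apply: (cvg_comp (- l) Phi) cvg_std_normal_cdfNy; exact/cvgNrNy.
  rewrite -[0 : R]subr0 -{1}oppr0 -[X in _ - X](scaler0 _ (t * c)).
  by apply: cvgB; [exact: cvgN|exact: cvgZr].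
- apply/cvg_at_right_filter/differentiable_continuous/derivable1_diffP.
  exact: FdE.
- by move=> u _; rewrite derive1E; have [_ ->] := dF u.
Qed.

End std_normal.

(** * Rayleigh mixtures of normal densities *)

Section mvnormal.
Context {R : realType} {n : nat}.

Lemma mvnormal_pdf_ge0 (S : 'M[R]_n) (z : 'cV[R]_n) : 0 <= mvnormal_pdf S z.
Proof. by rewrite mulr_ge0 ?expR_ge0// invr_ge0 sqrtr_ge0. Qed.

(** The completed square isolates the dependence on u, and
det Omega = k^2 det Sigma yields the factor k between the normalising
constants; the form k^2 u is chosen to fit the one-dimensional integral. *)
Lemma rayleigh_mvnormal_pdf (Sigma : 'M[R]_n) (gamma z : 'cV[R]_n) (u : R) :
  posdef Sigma -> 0 <= u ->
  let k := Num.sqrt (1 + dotv gamma (invmx Sigma *m gamma)) in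
  let t := dotv (k^-1 *: (invmx Sigma *m gamma)) z in
  rayleigh_pdf u * mvnormal_pdf Sigma (z - u *: gamma) =
  mvnormal_pdf (Sigma + gamma *m gamma^T) z / k *
    (k ^+ 2 * u * expR (- (k * u - t) ^+ 2 / 2)).
Proof.
move=> Sp u0 k t.
have a0 : 0 < 1 + dotv gamma (invmx Sigma *m gamma).
  by rewrite ltr_pwDl// posdef_invmx_ge0.
have k0 : k != 0 by rewrite gt_eqF// sqrtr_gt0.
rewrite /rayleigh_pdf u0 /mvnormal_pdf det_posdef_rank1//.
rewrite [_ * (_ * (1 + _))]mulrA [_ * (1 + _)]mulrC.
rewrite (sqrtrM _ (ltW a0)) -/k invfM.
set S := (Num.sqrt _)^-1.
have -> : u * expR (- u ^+ 2 / 2) * (S * expR (- dotv (z - u *: gamma)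
      (invmx Sigma *m (z - u *: gamma)) / 2)) =
    u * S * expR (- (u ^+ 2 + dotv (z - u *: gamma)
      (invmx Sigma *m (z - u *: gamma))) / 2).
  by rewrite mulrACA -expRD -mulrDl -opprD.
rewrite mahalanobis_rank1// -/k -/t opprD mulrDl expRD.
by move: (expR _) (expR _) => e1 e2; field.
Qed.

Lemma rayleigh_mvnormal_integral (Sigma : 'M[R]_n) (gamma z : 'cV[R]_n) :
  posdef Sigma ->
  let k := Num.sqrt (1 + dotv gamma (invmx Sigma *m gamma)) in
  let t := dotv (k^-1 *: (invmx Sigma *m gamma)) z in
  (\int[lebesgue_measure]_u
     (rayleigh_pdf u * mvnormal_pdf Sigma (z - u *: gamma)%R)%:E)%E =
  (Num.sqrt (2 * pi) / k * mvnormal_pdf (Sigma + gamma *m gamma^T) z *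
    std_normal_cdf t * (inv_mills t + t))%:E.
Proof.
move=> Sp k t.
have a0 : 0 < 1 + dotv gamma (invmx Sigma *m gamma).
  by rewrite ltr_pwDl// posdef_invmx_ge0.
have k0 : 0 < k by rewrite sqrtr_gt0.
set C := mvnormal_pdf (_ + _) z.
pose G u := k ^+ 2 * u * expR (- (k * u - t) ^+ 2 / 2).
have mG : measurable_fun [set: R] G.
  apply: measurable_funM; first exact: measurable_funM.
  apply: measurableT_comp => //; apply: measurable_funM => //.
  apply: measurableT_comp => //; apply: measurable_funX => //.
  by apply: measurable_funB => //; exact: measurable_funM.
transitivity (\int[lebesgue_measure]_(u in `[0%R, +oo[) ((C / k)%:E * (G u)%:E))%E.
  rewrite [RHS]integral_mkcond; apply: eq_integral => u _.
  rewrite patchE mem_setE in_itv/= andbT; case: ifPn => [u0|/negbTE u0].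
    by rewrite rayleigh_mvnormal_pdf.
  by rewrite /rayleigh_pdf u0 mul0r.
rewrite ge0_integralZl//; last 3 first.
- by apply/measurable_EFinP; exact: measurable_funTS.
- move=> u /=; rewrite in_itv/= andbT => u0.
  by rewrite lee_fin !mulr_ge0 ?expR_ge0// ltW.
- by rewrite lee_fin divr_ge0 ?mvnormal_pdf_ge0// ltW.
rewrite integral_shifted_gauss_moment// -EFinM /inv_mills std_normal_pdfE.
congr EFin.
have Phi0 : std_normal_cdf t != 0 by rewrite gt_eqF// std_normal_cdf_gt0.
have c0 : Num.sqrt (2 * pi) != 0 :> R.
  by rewrite gt_eqF// sqrtr_gt0 mulr_gt0// pi_gt0.
have := lt0r_neq0 k0 => kn0.
by field; rewrite kn0 Phi0 c0.
Qed.

End mvnormal.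

Theorem mainTheorem7 (R : realType) (disp : measure_display)
    (T : measurableType disp) (P : probability T R) (d : nat)
    (Sigma : 'M[R]_d) (gamma : 'cV[R]_d)
    (X : {RV P >-> 'cV[R]_d}) (U : {RV P >-> R})
    (Sigma_posdef : posdef Sigma)
    (X_normal : has_density P (lebesgue_cV d) X (mvnormal_pdf Sigma))
    (U_rayleigh : has_density P lebesgue_measure U rayleigh_pdf)
    (UX_indep : independent_RV U X) :
  let Omega := Sigma + gamma *m gamma^T in
  let alpha2 := dotv gamma (invmx Sigma *m gamma) in
  let eta := (Num.sqrt (1 + alpha2))^-1 *: (invmx Sigma *m gamma) in
  let Z := fun w : T => U w *: gamma + X w in
  has_density P (lebesgue_cV d) Z
    (fun z => Num.sqrt (2 * pi) * (Num.sqrt (1 + alpha2))^-1 *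
       mvnormal_pdf Omega z * std_normal_cdf (dotv eta z) *
       (inv_mills (dotv eta z) + dotv eta z)).
Proof.
move=> Omega alpha2 eta Z.
apply: (has_density_random_shift U_rayleigh X_normal UX_indep) => z.
exact: rayleigh_mvnormal_integral.
Qed.
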